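(* Let $n$ be an even positive integer and let $P$ be the perfect matching polytope of $K^n$. Consider a size-$r$ extension of $P$ and a corresponding randomized protocol of complexity $\lceil\lg r\rceil$ computing the slack matrix $S(P)$ in expectation, with normalized variance $\sigma^2$. Then $r=2^{\Omega(n(1-\sigma^2))}$ (as $n\to\infty$, with an absolute constant hidden in $\Omega$).
   Context: $\lg$ is the base-2 logarithm. $K^n$ is the complete graph on $[n]=\{1,\dots,n\}$. The perfect matching polytope of $K^n$ is the convex hull in $\mathbb{R}^{E(K^n)}$ of the characteristic vectors $\chi^M$ of perfect matchings $M$ of $K^n$. Its slack matrix $S(P)$ has one column per perfect matching $M$; its rows correspond to odd-cardinality sets $U\subseteq[n]$, with entry $|\delta(U)\cap M|-1$ (where $\delta(U)$ is the set of edges with exactly one endpoint in $U$), together with one row for each nonnegativity inequality $x_e\geqslant 0$, $e\in E(K^n)$, with entry $\chi^M_e$. An extension of $P$ is a polyhedron $Q$ together with a linear map $\pi$ with $\pi(Q)=P$; its size is the number of facets of $Q$. Randomized protocols (with private random bits and nonnegative outputs). Let $X,Y$ be the finite sets indexing the rows and columns of a nonnegative matrix $S$. A randomized protocol is a rooted binary tree in which each node has a type, $X$ or $Y$. Each internal node $v$ of type $X$ carries functions $p_{0,v},p_{1,v}:X\to[0,1]$ with $p_{0,v}(x)+p_{1,v}(x)\leqslant 1$ for all $x$; each internal node $v$ of type $Y$ carries functions $q_{0,v},q_{1,v}:Y\to[0,1]$ with $q_{0,v}(y)+q_{1,v}(y)\leqslant 1$ for all $y$. Each leaf $v$ of type $X$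 carries a nonnegative vector $\Lambda_v\in\mathbb{R}_+^X$, and each leaf $v$ of type $Y$ a nonnegative vector $\Lambda_v\in\mathbb{R}_+^Y$. An execution on input $(x,y)\in X\times Y$ is a random path starting at the root: at an internal node $v$ of type $X$ it goes to the left child with probability $p_{0,v}(x)$, to the right child with probability $p_{1,v}(x)$, and stops at $v$ with the remaining probability; at an internal node of type $Y$ it does the same with $q_{0,v}(y),q_{1,v}(y)$ (choices at different nodes being independent). The value of an execution stopping at a leaf $v$ is $\Lambda_v(x)$ if $v$ has type $X$ and $\Lambda_v(y)$ if $v$ has type $Y$; the value of an execution stopping at an internal node is $0$. The protocol computes $S$ in expectation if for every $(x,y)$ the expectation of the value $\xi_{x,y}$ of an execution on $(x,y)$ equals $S(x,y)$. The complexity of a protocol is the height of its tree. The normalized variance of a protocol computing $S$ in expectation is $\sigma^2=\max\{\mathrm{Var}(\xi_{x,y}/S(x,y)) : S(x,y)\neq 0\}$. *)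

(* Defs.v *)
From HB Require Import structures.
From mathcomp Require Import all_boot all_order all_algebra.
From mathcomp Require Import all_classical all_reals all_analysis.

Set Implicit Arguments.
Unset Strict Implicit.
Unset Printing Implicit Defensive.

Import Order.TTheory GRing.Theory Num.Theory.

Local Open Scope classical_set_scope.
Local Open Scope ring_scope.

Definition lg {R : realType} (x : R) : R := ln x / ln 2.

(* The vertices of K^n are the elements of ['I_n]. *)
Definition edge (n : nat) := {e : {set 'I_n} | #|e| == 2%N}.

Definition perfect_matching n (M : {set edge n}) : bool :=
  [forall v : 'I_n, #|[set e in M | v \in val e]| == 1%N].

Definition matching (n : nat) := {M : {set edge n} | perfect_matching M}.

Definition odd_set (n : nat) := {U : {set 'I_n} | odd #|U|}.

Definition cut n (U : {set 'I_n}) : {set edge n} :=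
  [set e : edge n | #|val e :&: U| == 1%N].


(* [R^o] is [R] seen as a vector space over itself, so that
   [{ffun edge n -> R^o}] is the vector space R^E(K^n). *)
Definition chi (R : realType) n (M : {set edge n}) : {ffun edge n -> R^o} :=
  [ffun e => (e \in M)%:R].

(* The finite family [v] is indexed by [I], so its convex hull is the set of
   convex combinations of the whole family. *)
Definition convex_hull (R : realType) (V : lmodType R) (I : finType)
    (v : I -> V) : set V :=
  [set x | exists l : I -> R,
     [/\ forall i, 0 <= l i, \sum_i l i = 1 & x = \sum_i l i *: v i]].

Definition matching_polytope (R : realType) (n : nat) :
    set {ffun edge n -> R^o} :=
  convex_hull (fun M : matching n => chi R (val M)).
Arguments matching_polytope : clear implicits.

Definition slack_row (n : nat) := (odd_set n + edge n)%type.

(* The subtraction is in [R], not truncated. *)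
Definition matching_slack (R : realType) n (x : slack_row n) (M : matching n) : R :=
  match x with
  | inl U => #|cut (val U) :&: val M|%:R - 1
  | inr e => chi R (val M) e
  end.
Arguments matching_slack : clear implicits.

Definition polyhedron (R : realType) d (Q : set 'rV[R]_d) : Prop :=
  exists m (A : 'M[R]_(d, m)) (b : 'rV[R]_m),
    Q = [set x | forall i, (x *m A) 0 i <= b 0 i].

(* [s] lists the differences to [p] of [k] further points of [S]; together
   with [p] these are [k.+1] affinely independent points of [S]. *)
Definition affine_dim_ge (R : realType) d (S : set 'rV[R]_d) (k : nat) : Prop :=
  exists (p : 'rV[R]_d) (s : k.-tuple 'rV[R]_d),
    [/\ S p, free s & forall i, S (p + tnth s i)].

(* For nonempty sets only: the empty set has no dimension. *)
Definition affine_dim (R : realType) d (S : set 'rV[R]_d) (k : nat) : Prop :=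
  affine_dim_ge S k /\ ~ affine_dim_ge S k.+1.

Definition face (R : realType) d (Q F : set 'rV[R]_d) : Prop :=
  exists (a : 'cV[R]_d) (b : R),
    (forall x, Q x -> (x *m a) 0 0 <= b) /\
    F = Q `&` [set x | (x *m a) 0 0 = b].

(* Nonempty faces of codimension 1; in particular the empty face of a
   one-point polyhedron is not counted as a facet. *)
Definition facet (R : realType) d (Q F : set 'rV[R]_d) : Prop :=
  face Q F /\ exists k, affine_dim F k /\ affine_dim Q k.+1.

Definition extension (R : realType) d (V : lmodType R) (P : set V)
    (Q : set 'rV[R]_d) (p : {linear 'rV[R]_d -> V}) : Prop :=
  polyhedron Q /\ p @` Q = P.

(* The facets are counted as sets, so that the size does not depend on a
   description of [Q] by inequalities. *)
Definition extension_size (R : realType) d (Q : set 'rV[R]_d) (r : nat) : Prop :=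
  ([set F | facet Q F] #= `I_r)%card.

(* [NodeX p0 p1 t0 t1] moves to [t0] with probability [p0 x], to [t1] with
   probability [p1 x], and stops otherwise. A node with a missing child is
   represented by a leaf that is reached with probability 0. *)
Inductive protocol (R X Y : Type) : Type :=
  | LeafX of (X -> R)
  | LeafY of (Y -> R)
  | NodeX of (X -> R) & (X -> R) & protocol R X Y & protocol R X Y
  | NodeY of (Y -> R) & (Y -> R) & protocol R X Y & protocol R X Y.

Fixpoint complexity R X Y (t : protocol R X Y) : nat :=
  match t with
  | LeafX _ | LeafY _ => 0
  | NodeX _ _ t0 t1 | NodeY _ _ t0 t1 => (maxn (complexity t0) (complexity t1)).+1
  end.

Definition subprobability (R : realType) X (p0 p1 : X -> R) : Prop :=
  forall x, [/\ 0 <= p0 x <= 1, 0 <= p1 x <= 1 & p0 x + p1 x <= 1].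

Fixpoint valid_protocol (R : realType) X Y (t : protocol R X Y) : Prop :=
  match t with
  | LeafX L => forall x, 0 <= L x
  | LeafY L => forall y, 0 <= L y
  | NodeX p0 p1 t0 t1 =>
      [/\ subprobability p0 p1, valid_protocol t0 & valid_protocol t1]
  | NodeY q0 q1 t0 t1 =>
      [/\ subprobability q0 q1, valid_protocol t0 & valid_protocol t1]
  end.

(* The law of the random execution on input [(x, y)]: one pair
   (probability, value) for each node of the tree at which the execution may
   stop. The probabilities along a path multiply because the choices at
   different nodes are independent. *)
Definition branch (R : realType) (p0 p1 : R) (s0 s1 : seq (R * R)) : seq (R * R) :=
  (1 - p0 - p1, 0) :: [seq (p0 * o.1, o.2) | o <- s0]
                   ++ [seq (p1 * o.1, o.2) | o <- s1].

Fixpoint execution (R : realType) X Y (t : protocol R X Y) (x : X) (y : Y) :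
    seq (R * R) :=
  match t with
  | LeafX L => [:: (1, L x)]
  | LeafY L => [:: (1, L y)]
  | NodeX p0 p1 t0 t1 =>
      branch (p0 x) (p1 x) (execution t0 x y) (execution t1 x y)
  | NodeY q0 q1 t0 t1 =>
      branch (q0 y) (q1 y) (execution t0 x y) (execution t1 x y)
  end.

(* If [xi] is the random value with law [s], these are the expectation and
   the variance of [g xi]. *)
Definition expect (R : realType) (s : seq (R * R)) (g : R -> R) : R :=
  \sum_(o <- s) o.1 * g o.2.

Definition var (R : realType) (s : seq (R * R)) (g : R -> R) : R :=
  expect s (fun xi => (g xi - expect s g) ^+ 2).

Definition computes (R : realType) X Y (t : protocol R X Y) (S : X -> Y -> R) : Prop :=
  forall x y, expect (execution t x y) id = S x y.

(* Variances of valid protocols are nonnegative, so the default value 0 of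
   the maximum only matters when [S] has no nonzero entry. *)
Definition normalized_variance (R : realType) (X Y : finType)
    (t : protocol R X Y) (S : X -> Y -> R) : R :=
  \big[Num.max/0]_(z : X * Y | S z.1 z.2 != 0)
    var (execution t z.1 z.2) (fun xi => xi / S z.1 z.2).

(* Main.v *)
(** An execution returns 0 with probability 1 where the slack vanishes and, since
    the value 0 deviates by 1 from the normalized mean, with probability at most
    sigma^2 elsewhere. This probability is a sum of fewer than 2^(h+1)
    nonnegative rank-one matrices, h being the height of the tree. Set
    disjointness on about n/4 points embeds in the zero pattern of the slack
    matrix, so it remains to bound the number K of rank-one terms of a
    nonnegative matrix B that is 1 on disjoint pairs and at most eps on
    intersecting pairs.

    Fix a set S and take uniform x inside S and y outside S. Such pairs are
    disjoint, so the K rectangles form a probability distribution depending on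
    (x, y), and the level-1 inequality bounds the total influence of the
    coordinates on it by O(ln K). Conversely, changing the side of a single i
    compares the bits (1,0) and (0,1) of i with (0,0); if i had little influence
    for both sides, these two distributions would be close, and by the rank-one
    identity B(1,0) B(0,1) = B(0,0) B(1,1) of each rectangle the weight of (1,1)
    could not be small. So ln K >= c |I| (1 - eps). *)
Require Import Defs.
From HB Require Import structures.
From mathcomp Require Import all_boot all_order all_algebra.
From mathcomp Require Import all_classical all_reals all_analysis.
From mathcomp Require Import ring lra zify.
Import Order.TTheory GRing.Theory Num.Theory.
Local Open Scope classical_set_scope.
Local Open Scope ring_scope.

Set Implicit Arguments.
Unset Strict Implicit.
Unset Printing Implicit Defensive.

(** * Uniform means and the level-1 inequality *)

Section Mean.
Variable R : realType.

Definition mean (T : finType) (F : T -> R) : R := (\sum_t F t) / #|T|%:R.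

Lemma eq_mean (T : finType) (F G : T -> R) : F =1 G -> mean F = mean G.
Proof. by move=> FG; rewrite /mean (eq_bigr _ (fun t _ => FG t)). Qed.

Lemma ler_mean (T : finType) (F G : T -> R) :
  (forall t, F t <= G t) -> mean F <= mean G.
Proof. by move=> FG; rewrite ler_wpM2r ?invr_ge0 ?ler0n// ler_sum. Qed.

Lemma mean_ge0 (T : finType) (F : T -> R) : (forall t, 0 <= F t) -> 0 <= mean F.
Proof. by move=> F0; rewrite divr_ge0 ?ler0n// sumr_ge0. Qed.

Lemma meanD (T : finType) (F G : T -> R) :
  mean (fun t => F t + G t) = mean F + mean G.
Proof. by rewrite /mean big_split mulrDl. Qed.

Lemma meanZ (T : finType) (c : R) (F : T -> R) :
  mean (fun t => c * F t) = c * mean F.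
Proof. by rewrite /mean -mulr_sumr mulrA. Qed.

Lemma mean_sum (T I : finType) (F : I -> T -> R) :
  mean (fun t => \sum_i F i t) = \sum_i mean (F i).
Proof. by rewrite /mean exchange_big mulr_suml. Qed.

Lemma mean_cst (T : finType) (c : R) (t0 : T) : mean (fun _ : T => c) = c.
Proof.
rewrite /mean sumr_const -[c *+ _]mulr_natr mulfK// pnatr_eq0 -lt0n.
by apply/card_gt0P; exists t0.
Qed.

Lemma mean_pair (S T : finType) (F : S -> R) (G : T -> R) :
  mean (fun z : S * T => F z.1 * G z.2) = mean F * mean G.
Proof.
rewrite /mean -(pair_bigA _ (fun s t => F s * G t))/= card_prod natrM invfM.
rewrite mulrACA; congr (_ * _); rewrite mulr_suml; apply: eq_bigr => s _.
by rewrite mulr_sumr.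
Qed.

(** For small [x], [expR y <= 1 / (1 - y)] at [x] and [- x] averages to [1 / (1 - x ^+ 2)];
    otherwise both [x] and [- x] are at most [2 * x ^+ 2]. *)
Lemma cosh_le (x : R) : (expR x + expR (- x)) / 2 <= expR (2 * x ^+ 2).
Proof.
have [x2|x2] := leP (x ^+ 2) (1/2).
  have inv_expR (y : R) : y < 1 -> expR y <= (1 - y)^-1.
    move=> y1; rewrite -[y in expR y]opprK expRN lef_pV2 ?posrE ?expR_gt0 ?subr_gt0//.
    exact: expR_ge1Dx.
  have x1 : x < 1 by nra.
  have Nx1 : - x < 1 by nra.
  have := inv_expR _ x1; have := inv_expR _ Nx1.
  have := expR_ge1Dx (2 * x ^+ 2).
  have : (1 - x)^-1 + (1 - - x)^-1 = 2 * (1 - x ^+ 2)^-1.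
    field; apply/andP; split; last apply/andP; try split; nra.
  have : (1 - x ^+ 2)^-1 <= 1 + 2 * x ^+ 2.
    rewrite -[leLHS]mul1r ler_pdivrMr; nra.
  lra.
have h (y : R) : y <= 2 * x ^+ 2 -> expR y <= expR (2 * x ^+ 2).
  by rewrite ler_expR.
have := h x ltac:(nra); have := h (- x) ltac:(nra); lra.
Qed.

(* Compare [E(w exp g)] with [E(exp g)] for the linear form
   [g = \sum_i a i / (4 * m) * chi i], using Jensen's inequality for the lower
   bound. The free parameter [K] replaces the logarithm of [1 / m]. *)
Lemma level1_ineq (T I : finType) (chi : I -> T -> R) (w : T -> R) (K : R)
    (m := mean w) (a := fun i => mean (fun t => w t * chi i t)) :
  (forall lam : I -> R, mean (fun t => expR (\sum_i lam i * chi i t))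
     <= expR (2 * \sum_i lam i ^+ 2)) ->
  (forall t, 0 <= w t <= 1) -> 0 < K ->
  \sum_i a i ^+ 2 / m <= 8 * (K^-1 - m + m * ln K).
Proof.
move=> mgf w01 K0.
have m_ge0 : 0 <= m by apply: mean_ge0 => t; case/andP: (w01 t).
have [m0|m_neq0] := eqVneq m 0.
  rewrite big1 => [|i _]; last by rewrite m0 invr0 mulr0.
  by rewrite m0 mul0r subr0 addr0 mulr_ge0// invr_ge0 ltW.
have m_gt0 : 0 < m by rewrite lt_neqAle eq_sym m_neq0.
pose L := \sum_i a i ^+ 2 / m ^+ 2.
(* The factor 1/4 maximizes [s * L - 2 * s ^+ 2 * L], the gap between the exponents of [lo] and
   [up]. *)
pose lam i := a i / m / 4.
pose g t := \sum_i lam i * chi i t.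
have wg : mean (fun t => w t * g t) = m * (L / 4).
  under eq_mean => t do rewrite mulr_sumr.
  rewrite mean_sum /L mulr_suml mulr_sumr; apply: eq_bigr => i _.
  under eq_mean => t do rewrite mulrCA.
  by rewrite meanZ -/(a i) /lam; field.
(* Tangent of [expR] at [L / 4], the [w]-weighted mean of [g]. *)
have lo : m * expR (L / 4) <= mean (fun t => w t * expR (g t)).
  have <- : mean (fun t => expR (L / 4) * (w t * g t + (1 - L / 4) * w t))
      = m * expR (L / 4).
    by rewrite meanZ meanD meanZ wg -/m; ring.
  apply: ler_mean => t; have /andP[w0 _] := w01 t.
  rewrite (_ : expR _ * _ = w t * (expR (L / 4) * (1 + (g t - L / 4)))); last by ring.
  rewrite ler_wpM2l//.
  rewrite -[g t in leRHS](subrKC (L / 4)) expRD ler_wpM2l ?expR_ge0//.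
  exact: expR_ge1Dx.
have up : mean (fun t => w t * expR (g t)) <= expR (L / 8).
  apply: (@le_trans _ _ (mean (fun t => expR (g t)))).
    apply: ler_mean => t; have /andP[_ w1] := w01 t.
    by rewrite ler_piMl ?expR_ge0.
  apply: le_trans (mgf lam) _.
  rewrite ler_expR /L mulr_suml mulr_sumr; apply: ler_sum => i _.
  by rewrite /lam le_eqVlt; apply/orP; left; apply/eqP; field.
have Lm : L / 8 <= - ln m.
  have := le_trans lo up.
  rewrite -[m in m * _]lnK ?posrE// -expRD ler_expR; lra.
have -> : \sum_i a i ^+ 2 / m = m * L.
  by rewrite /L mulr_sumr; apply: eq_bigr => i _; field.
have mK0 : 0 < m * K by rewrite mulr_gt0.
(* Trading [- ln m] for [ln K] leaves the error [K^-1 - m], which cancels when summed over [K]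
   weights of total 1. *)
have lnmK : - ln m - ln K <= (m * K)^-1 - 1.
  have -> : - ln m - ln K = ln (1 + ((m * K)^-1 - 1)).
    by rewrite subrKC lnV ?posrE// lnM ?posrE// opprD.
  by apply: le_ln1Dx; rewrite ltrBrDr addNr invr_gt0.
have : m * (L / 8) <= m * ((m * K)^-1 - 1 + ln K) by rewrite ler_wpM2l//; lra.
have -> : m * ((m * K)^-1 - 1 + ln K) = K^-1 - m + m * ln K.
  by field; rewrite m_neq0 gt_eqF.
lra.
Qed.
End Mean.

(** * Nonnegative factorizations of approximate disjointness *)

Section Disjointness.
Variables (R : realType) (I : finType).
Let cube : Type := {ffun I -> bool}.
Implicit Types (x y S : cube) (i j : I) (b : bool).

Definition upd i b x : cube := [ffun j => if j == i then b else x j].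
Definition flip i x : cube := upd i (~~ x i) x.
Definition band x y : cube := [ffun j => x j && y j].
Definition bneg x : cube := [ffun j => ~~ x j].
Definition sgn b : R := if b then 1 else -1.

Lemma flipK i : involutive (flip i).
Proof.
move=> x; apply/ffunP => j; rewrite !ffunE eqxx negbK.
by case: eqP => [->|].
Qed.

Lemma mean_upd i (F : cube -> R) :
  mean F = (mean (fun x => F (upd i true x)) + mean (fun x => F (upd i false x))) / 2.
Proof.
have flip_mean : mean (fun x => F (flip i x)) = mean F.
  by rewrite /mean [in RHS](reindex_inj (can_inj (flipK i))).
rewrite -meanD [X in _ = X / _](_ : _ = mean (fun x => F x + F (flip i x))); last first.
  apply: eq_mean => x.
  have -> : F x = F (upd i (x i) x).
    by congr (F _); apply/ffunP => j; rewrite ffunE; case: eqP => [->|].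
  by rewrite /flip; case: (x i) => //=; rewrite addrC.
by rewrite meanD flip_mean; field.
Qed.

Lemma mean_sgn i (F : cube -> R) :
  mean (fun x => F x * sgn (x i)) =
  (mean (fun x => F (upd i true x)) - mean (fun x => F (upd i false x))) / 2.
Proof.
rewrite (mean_upd i) -mulN1r -meanZ; congr ((_ + _) / _).
  by apply: eq_mean => x; rewrite ffunE eqxx mulr1.
by apply: eq_mean => x; rewrite ffunE eqxx/=; ring.
Qed.

Lemma mean_prod (F : I -> bool -> R) :
  mean (fun x : cube => \prod_i F i (x i)) = \prod_i ((F i true + F i false) / 2).
Proof.
rewrite /mean -bigA_distr_bigA card_ffun card_bool natrX big_split/=.
rewrite prodr_const exprVn; congr (_ * _).
by apply: eq_bigr => i _; rewrite big_bool.
Qed.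

(* The coordinates of a uniformly random disjoint pair [(x /\ S, y /\ ~ S)]
   that are not forced to vanish. *)
Definition free_bit S i (z : cube * cube) : R := sgn (if S i then z.1 i else z.2 i).

(** The free bits are independent uniform signs, so the mean factors into hyperbolic cosines. *)
Lemma free_bit_mgf S (lam : I -> R) :
  mean (fun z => expR (\sum_i lam i * free_bit S i z)) <= expR (2 * \sum_i lam i ^+ 2).
Proof.
pose F (s : bool) i b : R := if S i == s then expR (lam i * sgn b) else 1.
rewrite (_ : mean _ = mean (fun z : cube * cube =>
    (\prod_i F true i (z.1 i)) * (\prod_i F false i (z.2 i)))); last first.
  apply: eq_mean => z; rewrite expR_sum -big_split/=; apply: eq_bigr => i _.
  by rewrite /F /free_bit; case: (S i); rewrite ?mulr1 ?mul1r.
rewrite (mean_pair (fun x : cube => \prod_i F true i (x i))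
  (fun x : cube => \prod_i F false i (x i))) !mean_prod -big_split/=.
rewrite mulr_sumr expR_sum; apply: ler_prod => i _.
have -> : (F true i true + F true i false) / 2 * ((F false i true + F false i false) / 2)
    = (expR (lam i) + expR (- lam i)) / 2.
  by rewrite /F /sgn; case: (S i) => /=; rewrite mulr1 mulrN1; field.
by rewrite cosh_le divr_ge0 ?addr_ge0 ?expR_ge0.
Qed.

(* A lower bound for two squared Hellinger distances by the one between
   [U1 * V0] and [U0 * V1], whose product is that of [U0 * V0] and [U1 * V1];
   AM-GM with weight [s] splits the latter. *)
Lemma cut_and_paste (U0 U1 V0 V1 s : R) :
  0 <= U0 -> 0 <= U1 -> 0 <= V0 -> 0 <= V1 -> 0 < s ->
  (U1 * V0 + U0 * V1) / 2 - (s * (U0 * V0) + U1 * V1 / s) / 2 <=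
  (U1 * V0 - U0 * V0) ^+ 2 / (U1 * V0 + U0 * V0) +
  (U0 * V1 - U0 * V0) ^+ 2 / (U0 * V1 + U0 * V0).
Proof.
move=> hU0 hU1 hV0 hV1 s0.
rewrite -(sqr_sqrtr hU0) -(sqr_sqrtr hU1) -(sqr_sqrtr hV0) -(sqr_sqrtr hV1).
have := sqrtr_ge0 U0; have := sqrtr_ge0 U1.
have := sqrtr_ge0 V0; have := sqrtr_ge0 V1.
move: (Num.sqrt U0) (Num.sqrt U1) (Num.sqrt V0) (Num.sqrt V1).
move=> u0 u1 v0 v1 v1_ge0 v0_ge0 u1_ge0 u0_ge0 {U0 U1 V0 V1 hU0 hU1 hV0 hV1}.
(* Holds because [(p + q) ^+ 2 >= p ^+ 2 + q ^+ 2]. *)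
have hellinger (p q : R) : 0 <= p -> 0 <= q ->
    (p - q) ^+ 2 <= (p ^+ 2 - q ^+ 2) ^+ 2 / (p ^+ 2 + q ^+ 2).
  move=> p0 q0; have [e|ne] := eqVneq (p ^+ 2 + q ^+ 2) 0.
    have [-> ->] : p = 0 /\ q = 0 by split; nra.
    by rewrite subrr !expr0n/= subrr expr0n/= mul0r.
  rewrite ler_pdivlMr ?lt_neqAle 1?eq_sym ?ne ?addr_ge0 ?sqr_ge0//.
  rewrite subr_sqr exprMn ler_wpM2l ?sqr_ge0//; nra.
have := hellinger (u1 * v0) (u0 * v0) ltac:(nra) ltac:(nra).
have := hellinger (u0 * v1) (u0 * v0) ltac:(nra) ltac:(nra).
rewrite !exprMn => h1 h2.
apply: le_trans (lerD h2 h1).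
have amgm : 2 * ((u0 * v0) * (u1 * v1)) <= s * (u0 * v0) ^+ 2 + (u1 * v1) ^+ 2 / s.
  rewrite -subr_ge0 (_ : _ - _ = (s * (u0 * v0) - u1 * v1) ^+ 2 / s).
    by rewrite divr_ge0 ?sqr_ge0 ?ltW.
  by field; rewrite gt_eqF.
(* Parallelogram law: [(a-c)^2 + (b-c)^2 = (a-b)^2/2 + (a+b-2c)^2/2], with [c = u0 * v0]. *)
have := sqr_ge0 (u1 * v0 + u0 * v1 - 2 * (u0 * v0)).
rewrite !exprMn in amgm *; nra.
Qed.

(** Coordinate [i] is overwritten, so its membership in [S] is immaterial. *)
Lemma mean_upd_flip i S b (u : cube -> R) :
  mean (fun x => u (upd i b (band x (flip i S)))) =
  mean (fun x => u (upd i b (band x S))).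
Proof.
apply: eq_mean => x; congr (u _); apply/ffunP => j; rewrite !ffunE.
by case: eqP.
Qed.

Lemma bneg_flip i S : bneg (flip i S) = flip i (bneg S).
Proof. by apply/ffunP => j; rewrite !ffunE; case: eqP => // ->. Qed.

(** The constant is 64 = 4 * 16: averaged over [S], each coordinate has influence at least
    [(1 - eps) / 4], and the total is at most [16 * ln k]. *)
Lemma ln_card_disjointness (J : finType) (u v : J -> cube -> R) (eps : R) :
  (forall r x, 0 <= u r x) -> (forall r y, 0 <= v r y) -> 0 <= eps ->
  (forall x y, (forall i, ~~ (x i && y i)) -> \sum_r u r x * v r y = 1) ->
  (forall x y i, x i -> y i -> \sum_r u r x * v r y <= eps) ->
  #|I|%:R * (1 - eps) / 64 <= ln (#|J|%:R : R).
Proof.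
move=> u0 v0 eps0 disj inter.
pose x0 : cube := [ffun=> false].
have J0 : (0 < #|J|)%N.
  rewrite lt0n; apply/eqP => /card0_eq J0.
  have /eqP := disj x0 x0 (fun i => ltac:(by rewrite ffunE)).
  by rewrite big1 => [|r]; [rewrite eq_sym oner_eq0|have := J0 r; rewrite inE].
pose k : R := #|J|%:R; have k0 : 0 < k by rewrite ltr0n.
pose U b S i r := mean (fun x => u r (upd i b (band x S))).
pose V b S i r := mean (fun y => v r (upd i b (band y (bneg S)))).
have U0 b S i r : 0 <= U b S i r by apply: mean_ge0.
have V0 b S i r : 0 <= V b S i r by apply: mean_ge0.
have UV b b' S i : \sum_r U b S i r * V b' S i r =
    mean (fun z : cube * cube => \sum_r u r (upd i b (band z.1 S)) *
       v r (upd i b' (band z.2 (bneg S)))).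
  rewrite mean_sum; apply: eq_bigr => r _.
  by rewrite /U /V -mean_pair.
have UV1 b b' S i : ~~ (b && b') -> \sum_r U b S i r * V b' S i r = 1.
  move=> bb'; rewrite UV -[RHS](@mean_cst _ (cube * cube)%type 1 (x0, x0)).
  apply: eq_mean => z; apply: disj => j; rewrite !ffunE.
  by case: eqP => // _; case: (S j); rewrite ?andbF.
have UV_eps S i : \sum_r U true S i r * V true S i r <= eps.
  rewrite UV -[leRHS](@mean_cst _ (cube * cube)%type eps (x0, x0)).
  by apply: ler_mean => z; apply: (inter _ _ i); rewrite ffunE eqxx.
(* Given [z], the [w S r z] are probabilities over [r]; [m] is the mean weight of [r] and [a] its
   level-1 coefficients. *)
pose w S r (z : cube * cube) := u r (band z.1 S) * v r (band z.2 (bneg S)).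
pose m S r := mean (w S r).
pose a S r i := mean (fun z => w S r z * free_bit S i z).
(* The means of [w S r] given the free bit [i], set for [P] and unset for [Q]. *)
pose P S i r := if S i then U true S i r * V false S i r
                else U false S i r * V true S i r.
pose Q S i r := U false S i r * V false S i r.
have bandT i S x b : S i -> band (upd i b x) S = upd i b (band x S).
  move=> Si; apply/ffunP => j; rewrite !ffunE.
  by case: eqP => // ->; rewrite Si andbT.
have bandF i S x : S i = false -> band x S = upd i false (band x S).
  move=> Si; apply/ffunP => j; rewrite !ffunE.
  by case: eqP => // ->; rewrite Si andbF.
have bnegE S i : bneg S i = ~~ S i by rewrite ffunE.
have meanS S i (f : cube -> R) : S i -> mean (fun x => f (band x S)) =
    (mean (fun x => f (upd i true (band x S))) +
     mean (fun x => f (upd i false (band x S)))) / 2.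
  move=> Si; rewrite (mean_upd i).
  by congr ((_ + _) / _); apply: eq_mean => x; rewrite bandT.
have meanSs S i (f : cube -> R) : S i -> mean (fun x => f (band x S) * sgn (x i)) =
    (mean (fun x => f (upd i true (band x S))) -
     mean (fun x => f (upd i false (band x S)))) / 2.
  move=> Si; rewrite (mean_sgn i (fun x => f (band x S))).
  by congr ((_ - _) / _); apply: eq_mean => x; rewrite bandT.
have meanN S i (f : cube -> R) : S i = false -> mean (fun x => f (band x S)) =
    mean (fun x => f (upd i false (band x S))).
  by move=> Si; apply: eq_mean => x; rewrite {1}(bandF i).
have mE S i r : m S r = (P S i r + Q S i r) / 2.
  rewrite /m (mean_pair (fun x => u r (band x S)) (fun y => v r (band y (bneg S)))).
  rewrite /P /Q /U /V; case: (boolP (S i)) => [Si|/negbTE Si].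
    rewrite (meanS _ i)// (meanN _ i); first by ring.
    by rewrite bnegE Si.
  rewrite (meanN _ i)// (meanS _ i); first by ring.
  by rewrite bnegE Si.
have aE S i r : a S r i = (P S i r - Q S i r) / 2.
  rewrite /a /P /Q /U /V /w /free_bit; case: (boolP (S i)) => [Si|/negbTE Si].
    rewrite (_ : mean _ = mean (fun z : cube * cube =>
      u r (band z.1 S) * sgn (z.1 i) * v r (band z.2 (bneg S)))); last first.
      by apply: eq_mean => z; rewrite mulrAC.
    rewrite (mean_pair (fun x => u r (band x S) * sgn (x i))
       (fun y => v r (band y (bneg S)))) meanSs// (meanN _ i); first by ring.
    by rewrite bnegE Si.
  rewrite (_ : mean _ = mean (fun z : cube * cube =>
    u r (band z.1 S) * (v r (band z.2 (bneg S)) * sgn (z.2 i)))); last first.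
    by apply: eq_mean => z; rewrite mulrA.
  rewrite (mean_pair (fun x => u r (band x S))
     (fun y => v r (band y (bneg S)) * sgn (y i))) meanSs; last by rewrite bnegE Si.
  by rewrite (meanN _ i)//; ring.
(* The influence of bit [i]: a chi-square type distance between the laws of [r] with the bit set and
   unset. *)
pose H S i := \sum_r (P S i r - Q S i r) ^+ 2 / (P S i r + Q S i r).
have HE S i : H S i = 2 * \sum_r a S r i ^+ 2 / m S r.
  rewrite mulr_sumr; apply: eq_bigr => r _.
  by rewrite aE (mE S i) invf_div; move: (_ + _)^-1 => t; field.
(* [S] and [flip i S] share the same [U] and [V] at [i], but bit [i] is free for [x] under one and
   for [y] under the other. *)
have Hflip S i : (1 - eps) / 2 <= H S i + H (flip i S) i.
  wlog Si : S / S i.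
    move=> wl; have [Si|Si] := boolP (S i); first exact: wl.
    rewrite [leRHS]addrC -{2}(flipK i S); apply: wl.
    by rewrite ffunE eqxx (negbTE Si).
  have flip_i : flip i S i = false by rewrite ffunE eqxx Si.
  have Uf b r : U b (flip i S) i r = U b S i r by apply: mean_upd_flip.
  have Vf b r : V b (flip i S) i r = V b S i r.
    by rewrite /V bneg_flip; apply: mean_upd_flip.
  rewrite /H -big_split/= /P /Q Si flip_i.
  under [X in _ <= X]eq_bigr => r _ do rewrite !Uf !Vf.
  (* By AM-GM [eps <= s ^+ 2], so [(s + eps / s) / 2 <= s] and [1 - s] is the claimed bound. *)
  pose s := (1 + eps) / 2.
  have s0 : 0 < s by rewrite /s; lra.
  apply: le_trans (ler_sum _ (fun r _ => cut_and_paste (U0 false S i r)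
    (U0 true S i r) (V0 false S i r) (V0 true S i r) s0)).
  rewrite sumrB -!mulr_suml !big_split/= -mulr_sumr -mulr_suml.
  rewrite (UV1 true false)// (UV1 false true)// (UV1 false false)// mulr1.
  have : (\sum_r U true S i r * V true S i r) / s <= s.
    rewrite ler_pdivrMr//; apply: le_trans (UV_eps S i) _.
    by have := sqr_ge0 (1 - eps); rewrite /s expr2; nra.
  by rewrite /s; lra.
have w01 S r z : 0 <= w S r z <= 1.
  rewrite mulr_ge0//=.
  have <- := disj (band z.1 S) (band z.2 (bneg S)).
    by rewrite (bigD1 r)//= lerDl sumr_ge0// => r' _; rewrite mulr_ge0.
  by move=> i; rewrite !ffunE; case: (S i); rewrite !(andbT,andbF).
have Hsum S : \sum_i H S i <= 16 * ln k.
  have m1 : \sum_r m S r = 1.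
    rewrite /m -mean_sum -[RHS](@mean_cst _ (cube * cube)%type 1 (x0, x0)).
    apply: eq_mean => z; apply: disj => i.
    by rewrite !ffunE; case: (S i); rewrite !(andbT,andbF).
  under eq_bigr => i _ do rewrite HE.
  rewrite -mulr_sumr exchange_big/=.
  have : \sum_r \sum_i a S r i ^+ 2 / m S r <= \sum_r 8 * (k^-1 - m S r + m S r * ln k).
    by apply: ler_sum => r _; apply: level1_ineq => //; apply: free_bit_mgf.
  have -> : \sum_r 8 * (k^-1 - m S r + m S r * ln k) = 8 * ln k.
    rewrite -mulr_sumr big_split/= sumrB (_ : \sum_r m S r * ln k = (\sum_r m S r) * ln k); last first.
      by rewrite mulr_suml.
    rewrite m1 sumr_const.
    by rewrite -[k^-1 *+ _]mulr_natr mulVf ?gt_eqF// subrr add0r mul1r.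
  lra.
have : \sum_S (\sum_i H S i) <= \sum_(S : cube) 16 * ln k by apply: ler_sum => S _.
rewrite exchange_big/=.
have : \sum_(i : I) \sum_(S : cube) (1 - eps) / 4 <= \sum_i \sum_(S : cube) H S i.
  apply: ler_sum => i _.
  (* Pairing [S] with [flip i S] makes [Hflip] applicable. *)
  have -> : \sum_(S : cube) H S i = \sum_S (H S i + H (flip i S) i) / 2.
    rewrite -mulr_suml big_split/=.
    have <- : \sum_(S : cube) H S i = \sum_(S : cube) H (flip i S) i.
      by rewrite (reindex_inj (can_inj (flipK i))).
    by field.
  by apply: ler_sum => S _; have := Hflip S i; lra.
have sum_cst (T : finType) (c : R) : \sum_(t : T) c = c * #|T|%:R.
  by rewrite sumr_const mulr_natr.
have N0 : 0 < #|{: cube}|%:R :> R by rewrite ltr0n; apply/card_gt0P; exists x0.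
rewrite !sum_cst => h1 /(le_trans h1).
by rewrite mulrAC ler_pM2r// -/k; lra.
Qed.
End Disjointness.

(** * The probability that a protocol outputs 0 *)

Section Protocols.
Variables (R : realType) (X Y : Type).
Implicit Types (t : protocol R X Y) (s : seq (R * R)).

Lemma expect_branch (p0 p1 : R) s0 s1 (g : R -> R) :
  expect (branch p0 p1 s0 s1) g =
  (1 - p0 - p1) * g 0 + p0 * expect s0 g + p1 * expect s1 g.
Proof.
rewrite /expect /branch big_cons big_cat !big_map/= addrA !mulr_sumr.
by congr (_ + _ + _); apply: eq_bigr => o _; rewrite mulrA.
Qed.

Lemma expect_execution_ge0 t x y (g : R -> R) : valid_protocol t ->
  (forall a, 0 <= a -> 0 <= g a) -> 0 <= expect (execution t x y) g.
Proof.
move=> + g0; elim: t => [L|L|p0 p1 t0 IH0 t1 IH1|p0 p1 t0 IH0 t1 IH1] /=.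
- by move=> L0; rewrite /expect big_seq1/= mul1r g0.
- by move=> L0; rewrite /expect big_seq1/= mul1r g0.
- move=> [hp /IH0 h0 /IH1 h1]; rewrite expect_branch.
  have [/andP[p00 _] /andP[p10 _] p01] := hp x.
  by rewrite !addr_ge0 ?mulr_ge0 ?g0//; lra.
move=> [hp /IH0 h0 /IH1 h1]; rewrite expect_branch.
have [/andP[p00 _] /andP[p10 _] p01] := hp y.
by rewrite !addr_ge0 ?mulr_ge0 ?g0//; lra.
Qed.

Lemma expect_execution_le t x y (g h : R -> R) : valid_protocol t ->
  (forall a, 0 <= a -> g a <= h a) ->
  expect (execution t x y) g <= expect (execution t x y) h.
Proof.
move=> vt gh; rewrite -subr_ge0 /expect -sumrB.
under eq_bigr => o _ do rewrite -mulrBr.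
apply: (expect_execution_ge0 x y vt (g := fun a => h a - g a)) => a a0.
by rewrite subr_ge0 gh.
Qed.

Lemma expect_execution1 t x y : expect (execution t x y) (fun=> 1) = 1.
Proof.
elim: t => [L|L|p0 p1 t0 IH0 t1 IH1|p0 p1 t0 IH0 t1 IH1] /=.
- by rewrite /expect big_seq1/= mul1r.
- by rewrite /expect big_seq1/= mul1r.
- by rewrite expect_branch IH0 IH1; ring.
by rewrite expect_branch IH0 IH1; ring.
Qed.

Definition is_zero (a : R) : R := (a == 0)%:R.

Lemma is_zero0 : is_zero 0 = 1.
Proof. by rewrite /is_zero eqxx. Qed.

(** Outputs are nonnegative, so mean 0 forces each branch to have probability 0 or mean 0. *)
Lemma zero_prob_eq1 t x y : valid_protocol t ->
  expect (execution t x y) id = 0 -> expect (execution t x y) is_zero = 1.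
Proof.
have pos0 (p e e' : R) : 0 <= p -> 0 <= e -> p * e = 0 -> (e = 0 -> e' = 1) ->
    p * e' = p.
  by move=> _ _ /eqP; rewrite mulf_eq0 => /orP[]/eqP-> h; rewrite ?mul0r// h// mulr1.
elim: t => [L|L|p0 p1 t0 IH0 t1 IH1|p0 p1 t0 IH0 t1 IH1] /=.
- by move=> _; rewrite /expect !big_seq1/= !mul1r /is_zero => ->; rewrite eqxx.
- by move=> _; rewrite /expect !big_seq1/= !mul1r /is_zero => ->; rewrite eqxx.
- move=> [hp v0 v1]; rewrite !expect_branch.
  have [/andP[p00 _] /andP[p10 _] _] := hp x.
  have e0 := expect_execution_ge0 x y v0 (g := id) ltac:(by []).
  have e1 := expect_execution_ge0 x y v1 (g := id) ltac:(by []).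
  rewrite mulr0 add0r is_zero0 => /eqP.
  rewrite paddr_eq0 ?mulr_ge0// => /andP[/eqP z0 /eqP z1].
  rewrite (pos0 _ _ _ p00 e0 z0 (IH0 v0)) (pos0 _ _ _ p10 e1 z1 (IH1 v1)); ring.
move=> [hp v0 v1]; rewrite !expect_branch.
have [/andP[p00 _] /andP[p10 _] _] := hp y.
have e0 := expect_execution_ge0 x y v0 (g := id) ltac:(by []).
have e1 := expect_execution_ge0 x y v1 (g := id) ltac:(by []).
rewrite mulr0 add0r is_zero0 => /eqP.
rewrite paddr_eq0 ?mulr_ge0// => /andP[/eqP z0 /eqP z1].
rewrite (pos0 _ _ _ p00 e0 z0 (IH0 v0)) (pos0 _ _ _ p10 e1 z1 (IH1 v1)); ring.
Qed.

(* If [S x y != 0] then [xi / S x y] has mean 1, so it deviates by 1 from its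
   mean when [xi = 0]. *)
Lemma zero_prob_le_var t (S : X -> Y -> R) x y : valid_protocol t ->
  computes t S -> S x y != 0 ->
  expect (execution t x y) is_zero <= var (execution t x y) (fun xi => xi / S x y).
Proof.
move=> vt ct S0.
have E1 : expect (execution t x y) (fun xi => xi / S x y) = 1.
  rewrite /expect; under eq_bigr => o _ do rewrite mulrA.
  by rewrite -mulr_suml; have := ct x y; rewrite /expect => ->; rewrite mulfV.
rewrite /var E1; apply: expect_execution_le => // a _; rewrite /is_zero.
by case: eqP => [->|_]; rewrite ?sqr_ge0// mul0r sub0r sqrrN expr1n.
Qed.

(** One rectangle per node: the probability of stopping there with value 0 is a function of [x]
    times one of [y]. A binary tree of height [h] has fewer than [2 ^ h.+1] nodes. *)
Lemma zero_prob_rectangles t : valid_protocol t ->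
  exists (J : finType) (u : J -> X -> R) (v : J -> Y -> R),
  [/\ (#|J| < 2 ^ (complexity t).+1)%N,
      forall r x, 0 <= u r x, forall r y, 0 <= v r y &
      forall x y, expect (execution t x y) is_zero = \sum_r u r x * v r y].
Proof.
have card_node k0 k1 h0 h1 : (k0 < 2 ^ h0.+1)%N -> (k1 < 2 ^ h1.+1)%N ->
    (1 + (k0 + k1) < 2 ^ (maxn h0 h1).+2)%N.
  move=> k0h k1h.
  have h0m : (2 ^ h0.+1 <= 2 ^ (maxn h0 h1).+1)%N by rewrite leq_pexp2l// ltnS leq_maxl.
  have h1m : (2 ^ h1.+1 <= 2 ^ (maxn h0 h1).+1)%N by rewrite leq_pexp2l// ltnS leq_maxr.
  by rewrite [X in (_ < X)%N]expnS; lia.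
elim: t => [L|L|p0 p1 t0 IH0 t1 IH1|p0 p1 t0 IH0 t1 IH1] /=.
- move=> _; exists unit, (fun _ x => is_zero (L x)), (fun _ _ => 1).
  split => [|r x|r y|x y]; rewrite ?card_unit ?ler0n//.
  by rewrite /expect big_seq1 (big_pred1 tt) => [|[]//]; rewrite /= mulr1 mul1r.
- move=> _; exists unit, (fun _ _ => 1), (fun _ y => is_zero (L y)).
  split => [|r x|r y|x y]; rewrite ?card_unit ?ler0n//.
  by rewrite /expect big_seq1 (big_pred1 tt) => [|[]//].
- move=> [hp v0 v1].
  have [J0 [u0 [w0 [c0 u0_ge0 w0_ge0 E0]]]] := IH0 v0.
  have [J1 [u1 [w1 [c1 u1_ge0 w1_ge0 E1]]]] := IH1 v1.
  exists (unit + (J0 + J1))%type.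
  exists (fun r x => match r with inl _ => 1 - p0 x - p1 x
    | inr (inl r) => p0 x * u0 r x | inr (inr r) => p1 x * u1 r x end).
  exists (fun r y => match r with inl _ => 1
    | inr (inl r) => w0 r y | inr (inr r) => w1 r y end).
  split => [|[?|[r|r]] x|[?|[r|r]] y|x y]//.
  + by rewrite !card_sum card_unit card_node.
  + by have [_ _] := hp x; lra.
  + by rewrite mulr_ge0//; have [/andP[]] := hp x.
  + by rewrite mulr_ge0//; have [_ /andP[]] := hp x.
  rewrite expect_branch !big_sumType/= (big_pred1 tt) => [|[]//].
  rewrite is_zero0 mulr1 E0 E1 !mulr_sumr -addrA; congr (_ + (_ + _)).
    by apply: eq_bigr => r _; rewrite mulrA.
  by apply: eq_bigr => r _; rewrite mulrA.
move=> [hp v0 v1].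
have [J0 [u0 [w0 [c0 u0_ge0 w0_ge0 E0]]]] := IH0 v0.
have [J1 [u1 [w1 [c1 u1_ge0 w1_ge0 E1]]]] := IH1 v1.
exists (unit + (J0 + J1))%type.
exists (fun r x => match r with inl _ => 1
  | inr (inl r) => u0 r x | inr (inr r) => u1 r x end).
exists (fun r y => match r with inl _ => 1 - p0 y - p1 y
  | inr (inl r) => p0 y * w0 r y | inr (inr r) => p1 y * w1 r y end).
split => [|[?|[r|r]] x|[?|[r|r]] y|x y]//.
+ by rewrite !card_sum card_unit card_node.
+ by have [_ _] := hp y; lra.
+ by rewrite mulr_ge0//; have [/andP[]] := hp y.
+ by rewrite mulr_ge0//; have [_ /andP[]] := hp y.
rewrite expect_branch !big_sumType/= (big_pred1 tt) => [|[]//].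
rewrite mul1r is_zero0 mulr1 E0 E1 !mulr_sumr -addrA; congr (_ + (_ + _)).
  by apply: eq_bigr => r _; rewrite mulrCA.
by apply: eq_bigr => r _; rewrite mulrCA.
Qed.
End Protocols.

(** * Perfect matchings from fixed-point-free involutions *)

Section InvolutionMatching.
Variables (n : nat) (f : 'I_n -> 'I_n).
Hypotheses (fK : involutive f) (f_neq : forall i, f i != i).

Definition involution_matching : {set edge n} :=
  [set e : edge n | [forall (i | i \in val e), f i \in val e]].

Fact card_involution_pair i : #|[set i; f i]%SET| == 2%N.
Proof. by rewrite cards2 (eq_sym i) f_neq. Qed.

Definition involution_edge i : edge n := exist _ [set i; f i]%SET (card_involution_pair i).

Lemma involution_edge_in i : involution_edge i \in involution_matching.
Proof.
rewrite inE; apply/forall_inP => j /=.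
by rewrite !inE => /orP[]/eqP ->; rewrite ?fK eqxx ?orbT.
Qed.

Lemma involution_matchingE e i :
  e \in involution_matching -> i \in val e -> e = involution_edge i.
Proof.
rewrite inE => /forall_inP eM ie; apply/val_inj/esym/eqP => /=.
rewrite eqEcard (eqP (card_involution_pair i)) (eqP (valP e)) leqnn andbT.
by apply/fintype.subsetP => j; rewrite !inE => /orP[]/eqP ->; rewrite ?eM.
Qed.

Lemma involution_matching_perfect : perfect_matching involution_matching.
Proof.
apply/forallP => v; apply/cards1P; exists (involution_edge v).
apply/setP => e; rewrite !inE; apply/andP/eqP => [[eM ve]|->].
  by apply: involution_matchingE => //; rewrite inE.
by have := involution_edge_in v; rewrite inE => ->; rewrite /= !inE eqxx.
Qed.

(** A crossing edge corresponds to its unique endpoint in [U]. *)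
Lemma card_cut_involution (U : {set 'I_n}) :
  #|Defs.cut U :&: involution_matching| = #|[set v in U | f v \notin U]%SET|.
Proof.
have edge_inj : {in [set v in U | f v \notin U]%SET &, injective involution_edge}.
  move=> v w; rewrite !inE => /andP[vU fvU] /andP[wU fwU] /(congr1 val)/= vw.
  have : v \in [set w; f w]%SET by rewrite -vw !inE eqxx.
  by rewrite !inE => /orP[/eqP//|/eqP vfw]; rewrite -vfw vU in fwU.
rewrite -(card_in_imset edge_inj); apply: eq_card => e.
apply/setIP/imsetP => [[]|[v]].
  rewrite inE => /cards1P[v ev] eM.
  have /setIP[ve vU] : v \in val e :&: U by rewrite ev inE.
  have eE := involution_matchingE eM ve.
  exists v => //; rewrite inE vU/=; apply/negP => fvU.
  have : f v \in val e :&: U by rewrite inE fvU eE !inE eqxx orbT.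
  by rewrite ev inE (negbTE (f_neq v)).
rewrite inE => /andP[vU fvU] ->; split; last exact: involution_edge_in.
rewrite inE; apply/cards1P; exists v; apply/setP => j; rewrite !inE.
by case: eqP => [->//|_]/=; case: eqP => [->|]//=; rewrite (negbTE fvU).
Qed.

End InvolutionMatching.

(** * Embedding disjointness into the slack matrix *)

Section Gadget.
Variables (m k : nat).

(* Each element of the ground set owns a block of four vertices
   [(i, p, q)]; Alice's set selects the edge [p = false] of a block or nothing,
   Bob's set selects one of two perfect matchings of the block, and the cut has
   2 crossing edges in the block exactly when both own the element. The vertex
   [inr (ord0, false)] makes Alice's set odd. *)
Definition vertex : finType := ('I_m * bool * bool + 'I_k.+1 * bool)%type.

Lemma card_vertex : #|vertex| = (4 * m + 2 * k.+1)%N.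
Proof. rewrite card_sum !card_prod !card_ord card_bool; lia. Qed.

Definition alice (x : {ffun 'I_m -> bool}) : {set vertex} :=
  [set z | match z with
           | inl (i, p, q) => x i && ~~ p
           | inr (j, b) => (j == ord0) && ~~ b
           end]%SET.

Definition bob (y : {ffun 'I_m -> bool}) (z : vertex) : vertex :=
  match z with
  | inl (i, p, q) => if y i then inl (i, ~~ p, q) else inl (i, p, ~~ q)
  | inr (j, b) => inr (j, ~~ b)
  end.

Lemma bobK y : involutive (bob y).
Proof.
move=> [[[i p] q]|[j b]] /=; last by rewrite negbK.
by case: ifP => yi /=; rewrite yi negbK.
Qed.

Lemma bob_neq y z : bob y z != z.
Proof.
have negb_neq b : (~~ b == b) = false by case: b.
case: z => [[[i p] q]|[j b]] /=.
  case: ifP => _; apply/eqP => -[] /eqP; exact/negP/negbT/negb_neq.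
by apply/eqP => -[] /eqP; exact/negP/negbT/negb_neq.
Qed.

(** Selected edges contribute two vertices each, next to the single extra vertex. *)
Lemma odd_card_alice x : odd #|alice x|.
Proof.
rewrite -sum1_card big_mkcond big_sumType/=.
have -> : (\sum_(jb : 'I_k.+1 * bool) (if inr jb \in alice x then 1 else 0) = 1)%N.
  rewrite -big_mkcond (big_pred1 (ord0, false)) // => -[j b].
  by rewrite !inE xpair_eqE eqbF_neg.
rewrite (_ : \sum_(ipq : 'I_m * bool * bool) _ = \sum_(ip : 'I_m * bool)
    \sum_q (if inl (ip, q) \in alice x then 1 else 0))%N; last first.
  by rewrite pair_bigA; apply: eq_bigr => -[].
rewrite addn1 /= (eq_bigr (fun ip => (if x ip.1 && ~~ ip.2 then 1 else 0) * 2)%N).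
  by rewrite -big_distrl/= oddM andbF.
by move=> [i p] _ /=; rewrite big_bool !inE/= addnn muln2.
Qed.

Lemma cut_disjoint (x y : {ffun 'I_m -> bool}) : (forall i, ~~ (x i && y i)) ->
  [set z in alice x | bob y z \notin alice x]%SET = [set inr (ord0, false)]%SET.
Proof.
move=> xy; apply/setP => -[[[i p] q]|[j b]].
  by rewrite !inE/=; have := xy i; case: ifP => _; case: (x i); case: p.
rewrite !inE/= negbK [inr _ == _]xpair_eqE eqbF_neg.
by case: (j == _); case: b.
Qed.

Lemma cut_intersecting (x y : {ffun 'I_m -> bool}) i : x i -> y i ->
  (1 < #|[set z in alice x | bob y z \notin alice x]%SET|)%N.
Proof.
move=> xi yi; apply/card_gt1P.
exists (inr (ord0, false)), (inl (i, false, false)).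
by rewrite !inE/= yi xi.
Qed.

Variables (n : nat) (nE : #|vertex| = n).

Definition vertex_ord (z : vertex) : 'I_n := cast_ord nE (enum_rank z).
Definition ord_vertex (i : 'I_n) : vertex := enum_val (cast_ord (esym nE) i).

Lemma vertex_ordK : cancel vertex_ord ord_vertex.
Proof. by move=> z; rewrite /ord_vertex /vertex_ord cast_ordK enum_rankK. Qed.

Lemma ord_vertexK : cancel ord_vertex vertex_ord.
Proof. by move=> z; rewrite /vertex_ord enum_valK cast_ordKV. Qed.

Lemma slack_disjointness (R : realType) :
  exists (U : {ffun 'I_m -> bool} -> slack_row n)
         (M : {ffun 'I_m -> bool} -> matching n),
  (forall x y : {ffun 'I_m -> bool}, (forall i, ~~ (x i && y i)) ->
    matching_slack R n (U x) (M y) = 0) /\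
  (forall (x y : {ffun 'I_m -> bool}) i, x i -> y i ->
    matching_slack R n (U x) (M y) != 0).
Proof.
have ord_inj := can_inj vertex_ordK.
pose f y i := vertex_ord (bob y (ord_vertex i)).
have fK y : involutive (f y).
  by move=> i; rewrite /f vertex_ordK bobK ord_vertexK.
have f_neq y i : f y i != i.
  by rewrite -(inj_eq (can_inj ord_vertexK)) vertex_ordK bob_neq.
have U_odd x : odd #|vertex_ord @: alice x|.
  by rewrite card_imset// odd_card_alice.
exists (fun x => inl (exist (fun A : {set 'I_n} => odd #|A|) _ (U_odd x))).
exists (fun y => exist (@perfect_matching n) _
  (involution_matching_perfect (fK y) (f_neq y))).
have slackE x y : (#|Defs.cut (vertex_ord @: alice x) :&: involution_matching (f y)| =
    #|[set z in alice x | bob y z \notin alice x]%SET|)%N.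
  rewrite card_cut_involution// -(card_imset _ ord_inj); apply: eq_card => i.
  rewrite -[i]ord_vertexK inE /f vertex_ordK.
  by rewrite !(mem_imset _ _ ord_inj) !inE.
split=> [x y xy|x y i xi yi] /=; rewrite slackE.
  by rewrite cut_disjoint// cards1 subrr.
by rewrite subr_eq0 pnatr_eq1 gtn_eqF// (cut_intersecting xi yi).
Qed.
End Gadget.

(** * Assembling the bound *)

Unset Implicit Arguments.

Theorem mainTheorem4 (R : realType) :
  exists2 c : R, 0 < c &
  exists N : nat, forall n : nat, (0 < n)%N -> ~~ odd n -> (N <= n)%N ->
  forall (d r : nat) (Q : set 'rV[R]_d)
    (p : {linear 'rV[R]_d -> {ffun edge n -> R^o}})
    (t : protocol R (slack_row n) (matching n)),
  extension (matching_polytope R n) Q p ->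
  extension_size Q r ->
  valid_protocol t ->
  computes t (matching_slack R n) ->
  (complexity t)%:Z = Num.ceil (lg (r%:R : R)) ->
  2 `^ (c * n%:R * (1 - normalized_variance t (matching_slack R n))) <= r%:R.
Proof.
(* 1536 = 64 * 8 * 3: from [ln_card_disjointness], [n <= 8 * m], and [J_le]. *)
exists (1 / 1536); first lra.
exists 8 => n _ n_even n8 d r Q p t _ _ vt ct tr.
(* [m] blocks of four vertices and [k + 1] padding pairs fill up [n]; [8 <= n] ensures [0 < m]. *)
pose m := (n./2.-1)./2; pose k := odd n./2.-1.
have nE : #|vertex m k| = n.
  rewrite card_vertex /m /k; have := odd_double_half n.
  by have := odd_double_half n./2.-1; rewrite (negbTE n_even); lia.
have mn : (n <= 8 * m)%N.
  rewrite /m; have := odd_double_half n.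
  by have := odd_double_half n./2.-1; rewrite (negbTE n_even); lia.
have [U [M [SUM0 SUM1]]] := slack_disjointness nE R.
set var_t := normalized_variance _ _.
have zero_le x y : matching_slack R n x y != 0 ->
    expect (execution t x y) (@is_zero R) <= var_t.
  move=> S0; apply: le_trans (zero_prob_le_var vt ct S0) _.
  by rewrite /var_t /normalized_variance (bigmaxD1 (x, y))//= le_max lexx.
have var0 : 0 <= var_t by apply: bigmax_ge_id.
(* For [r <= 1] the height is 0 (with [ln 0 = 0]), so the protocol is one leaf and its value depends
   on one input only. This contradicts the slacks of the empty and the full set. *)
have r2 : (2 <= r)%N.
  rewrite ltnNge; apply/negP => r1.
  have : (complexity t)%:Z = 0.
    rewrite tr /lg; case: r r1 {tr} => [|[|//]] _.
      by rewrite ln0// mul0r ceil0.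
    by rewrite ln1 mul0r ceil0.
  have i0 : 'I_m by exists 0%N; lia.
  pose z : {ffun 'I_m -> bool} := [ffun=> false].
  pose o : {ffun 'I_m -> bool} := [ffun=> true].
  have Szo : matching_slack R n (U z) (M o) = 0 by apply: SUM0 => i; rewrite ffunE.
  have Soz : matching_slack R n (U o) (M z) = 0.
    by apply: SUM0 => i; rewrite !ffunE.
  have : matching_slack R n (U o) (M o) != 0 by apply: (SUM1 _ _ i0); rewrite ffunE.
  rewrite -!ct in Szo Soz *.
  case: {tr vt ct zero_le var0 var_t} t Szo Soz => [L|L|p0 p1 t0 t1|p0 p1 t0 t1]//=.
    by rewrite /expect !big_seq1 => _ ->; rewrite eqxx.
  by rewrite /expect !big_seq1 => -> _; rewrite eqxx.
have r0 : 0 < r%:R :> R by rewrite ltr0n; lia.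
have r2R : 2 <= r%:R :> R by rewrite (ler_nat R 2).
have [J [u [v [cardJ u0 v0 uvE]]]] := zero_prob_rectangles vt.
have ln_J : m%:R * (1 - var_t) / 64 <= ln (#|J|%:R : R).
  rewrite -[m in m%:R]card_ord.
  apply: (@ln_card_disjointness _ _ J (fun j x => u j (U x)) (fun j y => v j (M y))) => //.
    move=> x y xy; rewrite -uvE; apply: zero_prob_eq1 => //.
    by rewrite ct SUM0.
  move=> x y i xi yi; rewrite -uvE; apply: zero_le; exact: SUM1 xi yi.
have ln2_gt0 : 0 < ln 2 :> R by apply: ln_gt0; lra.
have ln2_le1 : ln 2 <= 1 :> R.
  by have := @le_ln1Dx R 1; rewrite (_ : 1 + 1 = 2)//; apply; lra.
(* The rounding and the [+1] in the node count cost [2 * ln 2], absorbed by [2 <= r]. *)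
have J_le : ln (#|J|%:R : R) <= 3 * ln r%:R.
  have [J0|J0] := posnP #|J|.
    by rewrite J0 ln0// mulr_ge0// ln_ge0//; lra.
  have : ln (#|J|%:R : R) <= (complexity t).+1%:R * ln 2.
    rewrite mulr_natl -lnXn// -natrX ler_ln ?posrE ?ltr0n ?expn_gt0//.
    by rewrite ler_nat ltnW.
  have : (complexity t)%:R < ln r%:R / ln 2 + 1 :> R.
    have := ceilB1_lt (lg (r%:R : R)); rewrite -tr /lg intrB; lra.
  rewrite -(ltr_pM2r ln2_gt0) mulrDl divfK ?gt_eqF// mul1r.
  have : ln 2 <= ln r%:R :> R by rewrite ler_ln ?posrE.
  rewrite -natr1; lra.
rewrite -[leRHS]lnK ?posrE// /powR pnatr_eq0/=.
rewrite ler_expR.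
(* For variance at least 1 the exponent is nonpositive and [1 <= r] suffices. *)
have [v1|v1] := leP 1 var_t.
  apply: (@le_trans _ _ 0); last by apply: ln_ge0; lra.
  have : 0 < 1 / 1536 :> R by lra.
  move: (1 / 1536) => c c0.
  rewrite -mulrA mulr_ge0_le0//; first by rewrite mulr_ge0// ltW.
  by rewrite mulr_le0_ge0 ?subr_le0// ltW.
have nm : n%:R <= 8 * m%:R :> R by rewrite -natrM ler_nat.
have v_le1 : 0 <= 1 - var_t by rewrite subr_ge0 ltW.
have := ler_wpM2r v_le1 nm.
have := ler_wpM2l (mulr_ge0 (ler0n R n) v_le1) ln2_le1.
lra.
Qed.
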